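(* Let $G$ be a compact Hausdorff topological group, let $n\ge 1$, and let $R$ be a directed poset. Let $\{A_r,\varphi_{rs},R\}$ be an inverse system of compact $G$-modules whose transition maps are $G$-group homomorphisms, such that $A_r$ is evenly continuous with respect to $G^{n-1}$ for all $r\in R$. Let $A=\varprojlim_{r\in R}A_r$ be a compact $G$-module presented as the inverse limit, with natural projections $\varphi_r:A\to A_r$. Then there exists a natural continuous bijection $$\Theta_n: H^n_{\mathrm{cts}}(G,A)_{\mathrm{po}}\longrightarrow \varprojlim_{r\in R}H^n_{\mathrm{cts}}(G,A_r)_{\mathrm{po}}\quad\text{given by}\quad [a]\longmapsto([\varphi_{r*}(a)])_{r\in R}.$$ In particular, if $A$ is evenly continuous with respect to $G^n$, then $\Theta_n$ is a homeomorphism.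
   Context: A $G$-module is a Hausdorff abelian topological group $A$ (written additively) with a continuous left action $G\times A\to A$, $(s,x)\mapsto{}^sx$, by group automorphisms. A $G$-group homomorphism is a continuous group homomorphism commuting with the $G$-actions. For topological spaces $A,B$, $M(B,A)_{\mathrm{po}}$ is the set of all maps $B\to A$ with the point-open topology (pointwise convergence, i.e. the product topology on $\prod_{b\in B}A$), and $M_{\mathrm{cts}}(B,A)_{\mathrm{po}}$ is the subspace of continuous maps. $G^m$ is the $m$-fold product with the product topology; $M_{\mathrm{cts}}(G^0,A)_{\mathrm{po}}$ denotes the set of constant maps $G\to A$, identified with $A$. For $m\ge1$, $d_m:M_{\mathrm{cts}}(G^{m-1},A)_{\mathrm{po}}\to M_{\mathrm{cts}}(G^m,A)_{\mathrm{po}}$ is $$d_mf_{s_1,\dots,s_m}={}^{s_1}f_{s_2,\dots,s_m}+\sum_{i=1}^{m-1}(-1)^if_{s_1,\dots,s_is_{i+1},\dots,s_m}+(-1)^mf_{s_1,\dots,s_{m-1}},$$ and $d_{m+1}d_m=0$. Put $Z^n_{\mathrm{cts}}(G,A)_{\mathrm{po}}=\ker d_{n+1}\subseteq M_{\mathrm{cts}}(G^n,A)_{\mathrm{po}}$ with the subspace topology. The group $M_{\mathrm{cts}}(G^{n-1},A)_{\mathrm{po}}$ acts on it by $(a,f)\mapsto a+d_nf$, and $H^n_{\mathrm{cts}}(G,A)_{\mathrm{po}}$ is the orbit space $Z^n_{\mathrm{cts}}(G,A)_{\mathrm{po}}/M_{\mathrm{cts}}(G^{n-1},A)_{\mathrm{po}}$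 with the quotient topology; $[a]$ is the class of $a$. A $G$-group homomorphism $\varphi$ induces $\varphi_*(a)=\varphi\circ a$ on cocycles and $[a]\mapsto[\varphi_*(a)]$ on classes; the inverse limit is taken along the maps induced by the $\varphi_{rs}$. A subset $F\subseteq M(B,A)$ is evenly continuous if for each $b\in B$, each $a\in A$ and each neighbourhood $U$ of $a$ there exist a neighbourhood $V$ of $b$ and a neighbourhood $W$ of $a$ such that for all $f\in F$, $f(b)\in W$ implies $f(V)\subseteq U$. The space $A$ is evenly continuous with respect to $B$ if $M_{\mathrm{cts}}(B,A)$ is evenly continuous; for $B=G^0$ this refers to the set of constant maps $G\to A$ (a condition which always holds). *)

(* Defs.v *)
From HB Require Import structures.
From mathcomp Require Import all_boot all_order all_algebra.
From mathcomp Require Import all_classical.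
From mathcomp Require Import topology tvs.

Set Implicit Arguments.
Unset Strict Implicit.
Unset Printing Implicit Defensive.

Import Order.TTheory GRing.Theory.

Local Open Scope classical_set_scope.
Local Open Scope ring_scope.
Local Open Scope quotient_scope.

HB.mixin Record isTopologicalGroup G & Topological G & Group G := {
  mulg_continuous : continuous (fun x : G * G => (x.1 * x.2)%g);
  invg_continuous : continuous (fun x : G => (x^-1)%g)
}.

#[short(type="topologicalGroupType")]
HB.structure Definition TopologicalGroup :=
  {G of Topological G & Group G & isTopologicalGroup G}.

HB.mixin Record isGModule (G : topologicalGroupType) A
    & TopologicalZmodule A := {
  gact : G -> A -> A;
  gact1 : forall x, gact 1%g x = x;
  gactM : forall s t x, gact (s * t)%g x = gact s (gact t x);
  gactD : forall s x y, gact s (x + y) = gact s x + gact s y;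
  gact_continuous : continuous (fun p : G * A => gact p.1 p.2);
  gmodule_hausdorff : hausdorff_space A
}.

#[short(type="gModuleType")]
HB.structure Definition GModule (G : topologicalGroupType) :=
  {A of TopologicalZmodule A & isGModule G A}.

HB.mixin Record isEquivariant (G : topologicalGroupType) (A B : gModuleType G)
    (f : A -> B) := {
  gactE : forall s x, f (gact s x) = gact s (f x)
}.

HB.structure Definition GHom (G : topologicalGroupType) (A B : gModuleType G) :=
  {f of isEquivariant G A B f & @GRing.Additive A B f & @Continuous A B f}.

Notation "{ 'ghom' A -> B }" := (GHom.type A B)
  (at level 0, A at level 98, B at level 99,
   format "{ 'ghom'  A  ->  B }") : type_scope.

Definition homeomorphism (X Y : topologicalType) (f : X -> Y) : Prop :=
  continuous f /\ exists g : Y -> X, [/\ cancel f g, cancel g f & continuous g].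

Definition evenly_continuous (B A : topologicalType) (F : set (B -> A)) : Prop :=
  forall (b : B) (a : A) (U : set A), nbhs a U ->
    exists V W, [/\ nbhs b V, nbhs a W &
      forall f, F f -> W (f b) -> f @` V `<=` U].

Definition evenly_continuous_wrt (A B : topologicalType) : Prop :=
  evenly_continuous [set f : B -> A | continuous f].

Definition Mcts (B A : topologicalType) : topologicalType :=
  set_type [set f : {ptws B -> A} | continuous (f : B -> A)].

Definition Mcts_fun (B A : topologicalType) (f : Mcts B A) : B -> A := \val f.

Lemma Mcts_continuous (B A : topologicalType) (f : Mcts B A) :
  continuous (Mcts_fun f).
Proof. exact: set_valP f. Qed.

(* For m = 0 this is the one-point space, so that [Mcts (gpow G 0) A] is a copy *)
(* of A, as is the space of constant maps G -> A.                               *)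
Definition gpow (G : topologicalGroupType) (m : nat) : topologicalType :=
  {ptws 'I_m -> G}.

Lemma evenly_continuous_gpow0 (G : topologicalGroupType) (A : topologicalType) :
  evenly_continuous_wrt A (gpow G 0).
Proof.
move=> b a U aU; exists setT, U; split=> //; first exact: filterT.
move=> f _ Ub _ [c _ <-]; have -> // : c = b.
by apply: functional_extensionality_dep => -[].
Qed.

Section Cochains.
Context (G : topologicalGroupType).

Section FixedModule.
Context (A : gModuleType G).

(* (s_1, ..., s_{m+1}) |-> (s_2, ..., s_{m+1}) *)
Definition tail_pow m (s : gpow G m.+1) : gpow G m :=
  fun j => s (lift ord0 j).

(* (s_1, ..., s_{m+1}) |-> (s_1, ..., s_m) *)
Definition init_pow m (s : gpow G m.+1) : gpow G m :=
  fun j => s (widen_ord (leqnSn m) j).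

(* (s_1, ..., s_{m+1}) |-> (s_1, ..., s_{i+1} s_{i+2}, ..., s_{m+1}) *)
Definition merge_pow m (i : 'I_m) (s : gpow G m.+1) : gpow G m := fun j =>
  if (j < i)%N then init_pow s j
  else if j == i then (init_pow s j * tail_pow s j)%g
  else tail_pow s j.

(* This is d_{m+1}; the ordinal i in the sum stands for the index i + 1 of the *)
(* usual formula.                                                              *)
Definition coboundary m (f : gpow G m -> A) : gpow G m.+1 -> A := fun s =>
  gact (s ord0) (f (tail_pow s))
  + \sum_(i < m) f (merge_pow i s) *~ (-1) ^+ i.+1
  + f (init_pow s) *~ (-1) ^+ m.+1.

Definition Zcts n : topologicalType :=
  set_type [set f : Mcts (gpow G n) A |
            forall s, coboundary (Mcts_fun f) s = 0].

Definition Zcts_fun n (a : Zcts n) : gpow G n -> A := Mcts_fun (\val a).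

(* The orbit relation of the action of [Mcts (gpow G n.-1) A]; the clause for *)
(* n = 0 is only there to make the definition total.                          *)
Definition cohomologous n : Zcts n -> Zcts n -> Prop :=
  match n with
  | 0 => fun a b => a = b
  | m.+1 => fun a b => exists f : Mcts (gpow G m) A,
      forall s, Zcts_fun b s = Zcts_fun a s + coboundary (Mcts_fun f) s
  end.

Lemma coboundary0 m (s : gpow G m.+1) :
  coboundary (fun=> 0) s = 0 :> A.
Proof.
have act0 t : gact t (0 : A) = 0.
  by apply: (addrI (gact t 0)); rewrite -gactD !addr0.
by rewrite /coboundary act0 big1 ?mul0rz ?addr0 // => i _; rewrite mul0rz.
Qed.

Lemma coboundaryD m (f g : gpow G m -> A) s :
  coboundary (fun t => f t + g t) s = coboundary f s + coboundary g s.
Proof.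
rewrite /coboundary gactD mulrzDl.
under eq_bigr => i _ do rewrite mulrzDl.
by rewrite big_split /= [RHS]addrACA [X in _ = X + _]addrACA.
Qed.

Lemma continuous_addf (X : topologicalType) (f g : X -> A) :
  continuous f -> continuous g -> continuous (fun t => f t + g t).
Proof.
move=> fc gc t; apply: (@continuous_comp _ _ _
  (fun t => (f t, g t)) (fun x : A * A => x.1 + x.2)).
  by apply: cvg_pair; [exact: fc|exact: gc].
exact: add_continuous.
Qed.

Lemma continuous_oppf (X : topologicalType) (f : X -> A) :
  continuous f -> continuous (fun t => - f t).
Proof.
move=> fc t; apply: (@continuous_comp _ _ _ f -%R); first exact: fc.
exact: opp_continuous.
Qed.

Lemma mem_Mcts (B C : topologicalType) (f : B -> C) (fc : continuous f) :
  (f : {ptws B -> C}) \in [set f : {ptws B -> C} | continuous (f : B -> C)].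
Proof. exact: mem_set. Qed.

Definition mkMcts (B C : topologicalType) (f : B -> C) (fc : continuous f) :
  Mcts B C := exist _ (f : {ptws B -> C}) (mem_Mcts fc).

Lemma mkMctsE (B C : topologicalType) (f : B -> C) (fc : continuous f) :
  Mcts_fun (mkMcts fc) = f.
Proof. by []. Qed.

Lemma cohomologous_refl n (a : Zcts n) : cohomologous a a.
Proof.
case: n a => [//|m] a.
have c0 : continuous (fun _ : gpow G m => (0 : A)) by exact: cst_continuous.
by exists (mkMcts c0) => s; rewrite mkMctsE coboundary0 addr0.
Qed.

Lemma cohomologous_trans n (a b c : Zcts n) :
  cohomologous a b -> cohomologous b c -> cohomologous a c.
Proof.
case: n a b c => [a b c -> //|m] a b c [f fP] [g gP].
have fgc := continuous_addf (Mcts_continuous (f:=f)) (Mcts_continuous (f:=g)).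
exists (mkMcts fgc) => s.
by rewrite mkMctsE coboundaryD gP fP [RHS]addrA.
Qed.

Lemma cohomologous_sym n (a b : Zcts n) :
  cohomologous a b -> cohomologous b a.
Proof.
case: n a b => [a b -> //|m] a b [f fP].
have fc := continuous_oppf (Mcts_continuous (f:=f)).
exists (mkMcts fc) => s; rewrite fP -addrA -coboundaryD.
rewrite [X in coboundary X](_ : _ = fun=> 0) ?coboundary0 ?addr0 //.
by apply/funext => t; rewrite mkMctsE subrr.
Qed.

Definition cohomologousb n : rel (Zcts n) := fun a b => `[< cohomologous a b >].

Lemma cohomologousb_refl n : reflexive (@cohomologousb n).
Proof. by move=> a; apply/asboolP; exact: cohomologous_refl. Qed.

Lemma cohomologousb_sym n : symmetric (@cohomologousb n).
Proof. by move=> a b; apply/asboolP/asboolP; exact: cohomologous_sym. Qed.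

Lemma cohomologousb_trans n : transitive (@cohomologousb n).
Proof.
by move=> b a c /asboolP ab /asboolP bc; apply/asboolP/(cohomologous_trans ab).
Qed.

Canonical cohomologous_equiv n := EquivRel (@cohomologousb n)
  (@cohomologousb_refl n) (@cohomologousb_sym n) (@cohomologousb_trans n).

Definition Hcts n : topologicalType :=
  quotient_topology {eq_quot (@cohomologousb n)}.

Definition Hclass n (a : Zcts n) : Hcts n :=
  \pi_(quotient_topology {eq_quot (@cohomologousb n)}) a.

Lemma Hclass_eq n (a b : Zcts n) : Hclass a = Hclass b <-> cohomologous a b.
Proof.
rewrite /Hclass; split=> [/eqmodP/asboolP//|ab].
by apply/eqmodP/asboolP.
Qed.

End FixedModule.

Section Functoriality.
Context (A B : gModuleType G) (phi : {ghom A -> B}).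

Lemma coboundary_comp m (f : gpow G m -> A) s :
  coboundary (phi \o f) s = phi (coboundary f s).
Proof.
rewrite /coboundary !raddfD /= gactE raddf_sum raddfMz.
by congr (_ + _ + _); apply: eq_bigr => i _; rewrite raddfMz.
Qed.

Lemma Mcts_push_subproof (X : topologicalType) (f : Mcts X A) :
  continuous (phi \o Mcts_fun f).
Proof.
move=> x; apply: continuous_comp; first exact: Mcts_continuous.
exact: cts_fun.
Qed.

Definition Mcts_push (X : topologicalType) (f : Mcts X A) : Mcts X B :=
  mkMcts (@Mcts_push_subproof X f).

Lemma Zcts_push_subproof n (a : Zcts A n) : Mcts_push (\val a) \in
  [set f : Mcts (gpow G n) B | forall s, coboundary (Mcts_fun f) s = 0].
Proof.
apply/mem_set => s; rewrite mkMctsE.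
by rewrite coboundary_comp (set_valP a) raddf0.
Qed.

Definition Zcts_push n (a : Zcts A n) : Zcts B n :=
  exist _ (Mcts_push (\val a)) (Zcts_push_subproof a).

Lemma Zcts_pushE n (a : Zcts A n) : Zcts_fun (Zcts_push a) = phi \o Zcts_fun a.
Proof. by []. Qed.

Definition Hcts_push n (x : Hcts A n) : Hcts B n := Hclass (Zcts_push (repr x)).

Lemma cohomologous_push n (a b : Zcts A n) :
  cohomologous a b -> cohomologous (Zcts_push a) (Zcts_push b).
Proof.
case: n a b => [a b -> //|m] a b [f fP]; exists (Mcts_push f) => s.
rewrite !Zcts_pushE mkMctsE coboundary_comp /=.
by rewrite fP raddfD.
Qed.

Lemma Hcts_pushE n (a : Zcts A n) : Hcts_push (Hclass a) = Hclass (Zcts_push a).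
Proof.
apply/Hclass_eq/cohomologous_push/Hclass_eq.
exact: (@reprK _ (quotient_topology {eq_quot (@cohomologousb A n)})).
Qed.

End Functoriality.
End Cochains.

Section InverseLimits.
Context (d : Order.disp_t) (R : porderType d).

Definition directed : Prop :=
  forall r s : R, exists t : R, (r <= t)%O /\ (s <= t)%O.

Section Topological.
Context (X : R -> topologicalType).
Context (f : forall r s : R, (s <= r)%O -> X r -> X s).

Definition invlim : topologicalType :=
  set_type [set x : prod_topology X |
            forall (r s : R) (h : (s <= r)%O), f h (x r) = x s].

Definition invlim_proj (x : invlim) (r : R) : X r := (\val x : prod_topology X) r.

Definition is_invlim (Y : topologicalType) (p : forall r, Y -> X r) : Prop :=
  exists2 u : Y -> invlim,
    (forall y r, invlim_proj (u y) r = p r y) & homeomorphism u.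

End Topological.

Record gInverseSystem (G : topologicalGroupType) := GInverseSystem {
  gsys_obj :> R -> gModuleType G;
  gsys_map : forall r s : R, (s <= r)%O -> {ghom gsys_obj r -> gsys_obj s};
  gsys_map_id : forall (r : R) (h : (r <= r)%O) x, gsys_map h x = x;
  gsys_map_comp : forall (r s t : R)
    (rs : (s <= r)%O) (st : (t <= s)%O) (rt : (t <= r)%O) x,
    gsys_map st (gsys_map rs x) = gsys_map rt x
}.

Record gSystemHom (G : topologicalGroupType) (S T : gInverseSystem G) :=
  GSystemHom {
  gsys_hom :> forall r, {ghom S r -> T r};
  gsys_hom_natural : forall (r s : R) (h : (s <= r)%O) x,
    gsys_hom s (gsys_map S h x) = gsys_map T h (gsys_hom r x)
}.

(* The [phi r] being G-group homomorphisms, the homeomorphism of [A] onto the *)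
(* subspace of compatible families in the product is one of G-modules.        *)
Definition is_gInvlim (G : topologicalGroupType) (S : gInverseSystem G)
    (A : gModuleType G) (phi : forall r, {ghom A -> S r}) : Prop :=
  @is_invlim (fun r => S r) (fun r s (h : (s <= r)%O) => gsys_map S h) A
    (fun r => phi r).

Definition Hcts_invlim (G : topologicalGroupType) (S : gInverseSystem G)
    (n : nat) : topologicalType :=
  @invlim (fun r => Hcts (S r) n)
    (fun r s (h : (s <= r)%O) => @Hcts_push G _ _ (gsys_map S h) n).

End InverseLimits.

(* Main.v *)
Require Import Defs.
From mathcomp Require Import all_boot all_order all_algebra.
From mathcomp Require Import all_classical.
From mathcomp Require Import topology tvs.

(** Write H(M) for the cohomology of degree m + 1 of a module M. The map Theta
    collects the maps induced by the projections [phi r], so naturality and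
    continuity are formal, and the content is bijectivity, which rests on one
    principle: a directed inverse system of nonempty compact Hausdorff spaces has
    a nonempty limit ([invlim_compact_nonempty]).

    Even continuity supplies the compactness. When M is compact Hausdorff and
    evenly continuous with respect to G^m, the continuous cochains G^m -> M are
    closed in the product of copies of M, hence compact for pointwise convergence
    ([evenly_continuous_compact]). As the coboundary is continuous for that
    topology, two families of spaces attached to M are compact: the cochains f
    with b = a + df for given a and b ([compact_primitives]), and the cocycles in
    a given class ([compact_Zcts_class]).

    Injectivity: if a and b become cohomologous over every r, the spaces of
    cochains witnessing this have a compatible family of points, and this family
    is a cochain over A with b = a + df ([cohomologous_glim]). Surjectivity: given
    compatible classes, the spaces of representing cocycles have a compatible
    family of points, which is a cocycle over A ([glim_cocycle]).

    For the last assertion, if A is evenly continuous with respect to G^(m+1) then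
    the cocycles of A, hence H(A), are compact ([compact_Hcts]). Each H(S r) is
    Hausdorff, being the quotient of the cocycles by the compact group of
    coboundaries ([hausdorff_Hcts]), so their limit is Hausdorff too, and a
    continuous bijection from a compact space to a Hausdorff space is a
    homeomorphism. *)

Set Implicit Arguments.
Unset Strict Implicit.
Unset Printing Implicit Defensive.

Import Order.TTheory GRing.Theory.

Local Open Scope classical_set_scope.
Local Open Scope ring_scope.

(** * Product and subspace topologies, compactness *)

Lemma continuous_to_prod (Z : topologicalType) (I : eqType)
    (X : I -> topologicalType) (h : Z -> prod_topology X) :
  (forall i, continuous (fun z => h z i)) -> continuous h.
Proof.
move=> hc z; apply/cvg_sup => i.
exact: (@continuous_comp_initial _ _ _
  (fun f : (forall i, X i) => f i) h (hc i) z).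
Qed.

Lemma continuous_eval (I : eqType) (X : I -> topologicalType) (i : I) :
  continuous (fun f : prod_topology X => f i).
Proof. exact: (@proj_continuous I X i). Qed.

Lemma continuous_to_set_type (Z X : topologicalType) (D : set X)
    (h : Z -> set_type D) :
  continuous (fun z => \val (h z)) -> continuous h.
Proof. by move=> hc; exact: (@continuous_comp_initial _ _ _ set_val h hc). Qed.

Lemma continuous_set_val (X : topologicalType) (D : set X) :
  continuous (fun x : set_type D => \val x).
Proof. exact: initial_continuous. Qed.

Lemma continuous_compose (X Y Z : topologicalType) (f : X -> Y) (g : Y -> Z) :
  continuous g -> continuous f -> continuous (fun x => g (f x)).
Proof. by move=> gc fc x; apply: continuous_comp; [exact: fc | exact: gc]. Qed.

Lemma continuous_pair (X Y Z : topologicalType) (f : X -> Y) (g : X -> Z) :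
  continuous f -> continuous g -> continuous (fun x => (f x, g x)).
Proof. by move=> fc gc x; apply: cvg_pair; [exact: fc | exact: gc]. Qed.

Lemma nbhs_preimage (X Y : topologicalType) (f : X -> Y) (x : X) (U : set Y) :
  continuous f -> nbhs (f x) U -> nbhs x (f @^-1` U).
Proof. by move=> fc fU; exact: fc fU. Qed.

Lemma closed_equalizer (X Y : topologicalType) (f g : X -> Y) :
  hausdorff_space Y -> continuous f -> continuous g ->
  closed [set x | f x = g x].
Proof.
move=> hY fc gc p clp; apply: hY => U V fU gV.
have [q [fgq [Uq Vq]]] :=
  clp _ (filterI (nbhs_preimage fc fU) (nbhs_preimage gc gV)).
by exists (f q); split=> //; rewrite fgq.
Qed.

Lemma hausdorff_injective (X Y : topologicalType) (f : X -> Y) :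
  injective f -> continuous f -> hausdorff_space Y -> hausdorff_space X.
Proof.
move=> fi fc hY p q clpq; apply/fi/hY => U V fU gV.
have [z [Uz Vz]] := clpq _ _ (nbhs_preimage fc fU) (nbhs_preimage fc gV).
by exists (f z).
Qed.

Lemma hausdorff_set_type (X : topologicalType) (D : set X) :
  hausdorff_space X -> hausdorff_space (set_type D).
Proof.
by apply: hausdorff_injective; [exact: val_inj | exact: continuous_set_val].
Qed.

Lemma continuous_image_compact (X Y : topologicalType) (f : X -> Y) (K : set X) :
  continuous f -> compact K -> compact (f @` K).
Proof. by move=> fc; apply: continuous_compact; exact: continuous_subspaceT. Qed.

Lemma compact_set_typeT (X : topologicalType) (D : set X) :
  compact D -> compact [set: set_type D].
Proof.
move=> cD F FF _.
have FD : (\val @ F) D by apply: (@filterE _ F) => x; exact: set_valP.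
have [p [Dp clp]] := cD _ (fmap_proper_filter _ FF) FD.
exists (exist _ p (mem_set Dp)); split=> // U V FU.
case=> _ [[O oO <-] Op OV].
have FW : (\val @ F) ((fun x : set_type D => \val x) @` U).
  by apply: (filterS (P := U)) FU => x Ux; exists x.
have [|_ [[y Uy <-] Oy]] := clp _ O FW; first exact: open_nbhs_nbhs.
by exists y; split=> //; apply: OV.
Qed.

Lemma compact_hausdorff_inverse (X Y : topologicalType) (f : X -> Y) (g : Y -> X) :
  compact [set: X] -> hausdorff_space Y -> continuous f ->
  cancel f g -> cancel g f -> continuous g.
Proof.
move=> cX hY fc fK gK; apply/continuous_closedP => C cC.
rewrite (_ : g @^-1` C = f @` C).
  apply: compact_closed => //; apply: continuous_image_compact => //.
  exact: subclosed_compact cX _.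
by apply/seteqP; split=> [y Cy|_ [x Cx <-]]; rewrite /= ?fK//; exists (g y).
Qed.

(** For each [t] the families in the product of the [K r] that are compatible
    below [t] form a nonempty closed set: push a point of [K t] down. As [R] is
    directed these sets form a filter base on the product, which is compact by
    Tychonoff, and a cluster point is compatible everywhere. *)
Lemma invlim_compact_nonempty (d : Order.disp_t) (R : porderType d)
    (X : R -> topologicalType) (f : forall r s : R, (s <= r)%O -> X r -> X s)
    (K : forall r, set (X r)) :
  directed R ->
  (forall r, hausdorff_space (X r)) ->
  (forall r s (h : (s <= r)%O), continuous (f r s h)) ->
  (forall r s t (rs : (s <= r)%O) (st : (t <= s)%O) (rt : (t <= r)%O) x,
     f s t st (f r s rs x) = f r t rt x) ->
  (forall r, compact (K r)) -> (forall r, K r !=set0) ->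
  (forall r s (h : (s <= r)%O) x, K r x -> K s (f r s h x)) ->
  exists x : invlim f, forall r, K r (invlim_proj x r).
Proof.
move=> dR hX fc fcomp cK K0 fK.
pose k r : X r := projT1 (cid (K0 r)).
have kK r : K r (k r) by rewrite /k; case: cid.
pose P : set (prod_topology X) := [set x | forall r, K r (x r)].
have cP : compact P by exact: tychonoff.
(* Over an empty index set the sets [E t] below give no filter base. *)
have [[r0 _]|R0] := pselect (exists r : R, True); last first.
  have kE : (k : prod_topology X) \in
      [set x : prod_topology X | forall r s (h : (s <= r)%O), f r s h (x r) = x s].
    by apply/mem_set => r; case: R0; exists r.
  by exists (exist _ (k : prod_topology X) kE).
pose E (t : R) : set (prod_topology X) := P `&` [set x | forall r s,
  (r <= t)%O -> forall h : (s <= r)%O, f r s h (x r) = x s].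
have E0 t : E t !=set0.
  pose y r := if pselect (r <= t)%O is left h then f t r h (k t) else k r.
  exists y; split=> [r|r s rt sr]; rewrite /y.
    by case: pselect => [rt|_]; [exact: fK | exact: kK].
  have st := Order.POrderTheory.le_trans sr rt.
  by case: pselect => // rt'; case: pselect => // st'; exact: fcomp.
pose F : set_system (prod_topology X) := filter_from setT E.
have FF : ProperFilter F.
  apply: filter_from_proper => //; apply: filter_from_filter; first by exists r0.
  move=> t t' _ _; have [u [tu t'u]] := dR t t'; exists u => // x [Px xu].
  by split; split=> // r s rt; apply: xu; apply: Order.POrderTheory.le_trans rt _.
have [|x [Px xF]] := cP F FF; first by exists r0 => // x [].
have xE : (x : prod_topology X) \in
    [set x : prod_topology X | forall r s (h : (s <= r)%O), f r s h (x r) = x s].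
  apply/mem_set => r s sr.
  suff cl : closed [set x : prod_topology X | f r s sr (x r) = x s].
    apply: cl => U xU; have FE : F (E r) by exists r.
    have [y [[Py Ey] Uy]] := xF _ _ FE xU.
    by exists y; split=> //; exact: Ey.
  apply: closed_equalizer => //; last exact: continuous_eval.
  by apply: continuous_compose => //; exact: continuous_eval.
by exists (exist _ x xE).
Qed.

(** Even continuity makes continuity survive pointwise limits: a limit [f] of
    continuous maps sends the neighbourhood [V] of [b] into the closure of a
    neighbourhood of [f b], which is small because [A] is regular. So the
    continuous maps form a closed subset of the compact space of all maps. *)
Lemma evenly_continuous_compact (B A : topologicalType) :
  hausdorff_space A -> compact [set: A] -> evenly_continuous_wrt A B ->
  compact [set f : {ptws B -> A} | continuous (f : B -> A)].
Proof.
move=> hA cA ec.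
have cT : compact [set f : {ptws B -> A} | forall b, [set: A] (f b)].
  exact: (@tychonoff B (fun=> A) (fun=> setT)).
apply: (subclosed_compact _ cT) => // f clf b U bU.
have [U' fU' U'U] := compact_regular hA cA (filterT (F := nbhs (f b))) bU.
have [V [W [bV fW VW]]] := ec b _ _ fU'.
apply: filterS bV => c Vc; apply: U'U => N fN.
have evc b' : continuous (fun g : {ptws B -> A} => g b').
  exact: continuous_eval.
have [g [gc [Wg Ng]]] := clf _ (filterI (nbhs_preimage (evc b) fW)
                                        (nbhs_preimage (evc c) fN)).
by exists (g c); split=> //; apply: (VW g gc Wg); exists c.
Qed.

(** * Cochains, cocycles and the topology of cohomology *)

Section Cochains.
Context (G : topologicalGroupType).

Lemma continuous_coord (m : nat) (i : 'I_m) : continuous (fun s : gpow G m => s i).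
Proof. exact: (@continuous_eval 'I_m (fun=> G) i). Qed.

Lemma continuous_to_gpow (Z : topologicalType) (m : nat) (h : Z -> gpow G m) :
  (forall i, continuous (fun z => h z i)) -> continuous h.
Proof. by move=> hc; exact: (@continuous_to_prod Z 'I_m (fun=> G) h hc). Qed.

Lemma continuous_tail_pow m : continuous (@tail_pow G m).
Proof. by apply: continuous_to_gpow => i; exact: continuous_coord. Qed.

Lemma continuous_init_pow m : continuous (@init_pow G m).
Proof. by apply: continuous_to_gpow => i; exact: continuous_coord. Qed.

Lemma continuous_merge_pow m (i : 'I_m) : continuous (merge_pow (G := G) i).
Proof.
apply: continuous_to_gpow => j; rewrite /merge_pow.
case: (j < i)%N; first exact: continuous_coord.
case: (j == i); last exact: continuous_coord.
apply: (@continuous_compose _ _ _ (fun s => (init_pow s j, tail_pow s j))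
  (fun x : G * G => (x.1 * x.2)%g)).
  exact: mulg_continuous.
by apply: continuous_pair; exact: continuous_coord.
Qed.

Section Module.
Context (A : gModuleType G).

Lemma continuous_mulrz (X : topologicalType) (f : X -> A) (z : int) :
  continuous f -> continuous (fun x => f x *~ z).
Proof.
move=> fc.
have Hn n : continuous (fun x => f x *+ n).
  elim: n => [|n IH]; first exact: cst_continuous.
  rewrite (_ : (fun x => _) = fun x => f x + f x *+ n).
    exact: continuous_addf.
  by apply/funext => x; rewrite mulrS.
case: z => n; first exact: Hn.
exact: continuous_oppf.
Qed.

Lemma continuous_sumf (X : topologicalType) (I : Type) (r : seq I)
    (F : I -> X -> A) :
  (forall i, continuous (F i)) -> continuous (fun x => \sum_(i <- r) F i x).
Proof.
move=> Fc; elim: r => [|i r IH].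
  under eq_fun do rewrite big_nil.
  exact: cst_continuous.
under eq_fun do rewrite big_cons.
exact: continuous_addf.
Qed.

(** Letting the cochain and its argument vary together gives at once that a
    coboundary is continuous, when only the argument moves, and that the
    coboundary is continuous for pointwise convergence, when only the cochain
    does. *)
Lemma continuous_coboundary_family (X : topologicalType) m
    (F : X -> gpow G m -> A) (s : X -> gpow G m.+1) :
  continuous s ->
  (forall face : gpow G m.+1 -> gpow G m, continuous face ->
     continuous (fun x => F x (face (s x)))) ->
  continuous (fun x => coboundary (F x) (s x)).
Proof.
move=> sc Fc; rewrite /coboundary; apply: continuous_addf.
  apply: continuous_addf.
    apply: (@continuous_compose _ _ _ (fun x => (s x ord0, F x (tail_pow (s x))))
      (fun p : G * A => gact p.1 p.2)).
      exact: gact_continuous.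
    apply: continuous_pair; last exact: (Fc _ (@continuous_tail_pow m)).
    apply: (@continuous_compose _ _ _ s (fun t => t ord0)) => //.
    exact: continuous_coord.
  apply: continuous_sumf => i; apply: continuous_mulrz.
  exact: (Fc _ (@continuous_merge_pow m i)).
apply: continuous_mulrz; exact: (Fc _ (@continuous_init_pow m)).
Qed.

Lemma continuous_coboundary m (f : gpow G m -> A) :
  continuous f -> continuous (coboundary f).
Proof.
move=> fc; apply: (@continuous_coboundary_family _ m (fun=> f) id).
  by move=> x; exact: cvg_id.
by move=> face; exact: (continuous_compose fc).
Qed.

Lemma continuous_coboundary_ptws m (s : gpow G m.+1) :
  continuous (fun f : {ptws gpow G m -> A} => coboundary f s).
Proof.
apply: (@continuous_coboundary_family _ m (fun f : {ptws gpow G m -> A} => f)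
          (fun=> s)).
  exact: cst_continuous.
by move=> face _; exact: continuous_eval.
Qed.

Lemma closed_cocycles m :
  closed [set f : {ptws gpow G m -> A} | forall s, coboundary f s = 0].
Proof.
move=> f clf s.
have cl : closed [set g : {ptws gpow G m -> A} | coboundary g s = 0].
  apply: closed_equalizer; first exact: gmodule_hausdorff.
    exact: continuous_coboundary_ptws.
  exact: cst_continuous.
by apply: cl => U /clf [g [gz Ug]]; exists g; split=> //; exact: gz.
Qed.

Lemma hausdorff_ptws (B : topologicalType) : hausdorff_space {ptws B -> A}.
Proof. by apply: (@hausdorff_product B (fun=> A)) => _; exact: gmodule_hausdorff. Qed.

Lemma continuous_Mcts_fun (B : topologicalType) :
  continuous (fun f : Mcts B A => Mcts_fun f : {ptws B -> A}).
Proof. exact: continuous_set_val. Qed.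

Lemma continuous_Zcts_fun n :
  continuous (fun a : Zcts A n => Zcts_fun a : {ptws gpow G n -> A}).
Proof.
apply: (@continuous_compose _ _ _ (fun a : Zcts A n => \val a)
  (fun f => Mcts_fun f : {ptws gpow G n -> A})).
  exact: continuous_Mcts_fun.
exact: continuous_set_val.
Qed.

Lemma continuous_Zcts_eval n (s : gpow G n) :
  continuous (fun a : Zcts A n => Zcts_fun a s).
Proof.
apply: (@continuous_compose _ _ _
  (fun a : Zcts A n => Zcts_fun a : {ptws gpow G n -> A}) (fun f => f s)).
  exact: continuous_eval.
exact: continuous_Zcts_fun.
Qed.

Lemma Zcts_fun_inj n : injective (@Zcts_fun G A n).
Proof. by move=> a b ab; do 2 apply: val_inj. Qed.

Lemma continuous_to_Zcts (X : topologicalType) n (h : X -> Zcts A n) :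
  (forall s, continuous (fun x => Zcts_fun (h x) s)) -> continuous h.
Proof.
move=> hc; do 2 apply: continuous_to_set_type.
by apply: (@continuous_to_prod X (gpow G n) (fun=> A)).
Qed.

Lemma Zcts_of_subproof n (f : gpow G n -> A) (fc : continuous f)
    (fz : forall s, coboundary f s = 0) :
  mkMcts fc \in [set g : Mcts (gpow G n) A | forall s, coboundary (Mcts_fun g) s = 0].
Proof. exact: mem_set. Qed.

Definition mkZcts n (f : gpow G n -> A) (fc : continuous f)
    (fz : forall s, coboundary f s = 0) : Zcts A n :=
  exist _ (mkMcts fc) (Zcts_of_subproof fc fz).

Lemma mkZctsE n (f : gpow G n -> A) (fc : continuous f)
    (fz : forall s, coboundary f s = 0) : Zcts_fun (mkZcts fc fz) = f.
Proof. by []. Qed.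

Lemma Zcts_cocycle n (a : Zcts A n) s : coboundary (Zcts_fun a) s = 0.
Proof. exact: (set_valP a). Qed.

Lemma Zcts_continuous n (a : Zcts A n) : continuous (Zcts_fun a).
Proof. exact: Mcts_continuous. Qed.

Lemma Hclass_surj n (x : Hcts A n) : exists a : Zcts A n, Hclass a = x.
Proof. by exists (repr x); exact: reprK. Qed.

Lemma continuous_Hclass n : continuous (@Hclass G A n).
Proof. exact: pi_continuous. Qed.

(** If b is cohomologous to a in [U], translating by a - b is continuous, sends b
    into [U] and preserves classes, a - b being a coboundary; hence the saturation
    of [U] is open. The translate of a cocycle is a cocycle because a - b is a
    difference of cocycles, so additivity of the coboundary is enough. *)
Lemma open_Hclass n (U : set (Zcts A n.+1)) :
  open U -> open (@Hclass G A n.+1 @` U).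
Proof.
move=> oU; rewrite /open /= /quotient_open openE => b [a Ua ab].
move/Hclass_eq/cohomologous_sym: ab => [f fP].
pose c s := Zcts_fun a s - Zcts_fun b s.
have cc : continuous c.
  by apply: continuous_addf; [|apply: continuous_oppf]; exact: Zcts_continuous.
have cz s : coboundary c s = 0.
  have := coboundaryD (Zcts_fun b) c s; rewrite Zcts_cocycle add0r => <-.
  rewrite (_ : (fun t => _) = Zcts_fun a) ?Zcts_cocycle//.
  by apply/funext => t; rewrite /c addrC subrK.
pose t (z : Zcts A n.+1) s := Zcts_fun z s + c s.
have tc z : continuous (t z).
  by apply: continuous_addf => //; exact: Zcts_continuous.
have tz z s : coboundary (t z) s = 0.
  by rewrite coboundaryD Zcts_cocycle cz addr0.
pose T z := mkZcts (tc z) (tz z).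
have Tc : continuous T.
  apply: continuous_to_Zcts => s; rewrite /T /= /t.
  apply: continuous_addf; last exact: cst_continuous.
  exact: continuous_Zcts_eval.
have Tb : T b = a.
  apply: Zcts_fun_inj; rewrite mkZctsE; apply/funext => s.
  by rewrite /t /c addrC subrK.
have TU : nbhs b (T @^-1` U).
  by apply: (nbhs_preimage Tc); rewrite Tb; exact: open_nbhs_nbhs.
apply: filterS TU => z Uz; exists (T z) => //.
apply/Hclass_eq/cohomologous_sym; exists f => s.
by rewrite mkZctsE /t /c fP [Zcts_fun b s + _]addrC addrK.
Qed.

Section Compact.
Context (m : nat).
Hypotheses (cA : compact [set: A]) (ec : evenly_continuous_wrt A (gpow G m)).

Lemma compact_coset_coboundaries (a : gpow G m.+1 -> A) :
  compact [set g : {ptws gpow G m.+1 -> A} |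
    exists2 f : gpow G m -> A, continuous f & g = (fun s => a s + coboundary f s)].
Proof.
pose D (f : {ptws gpow G m -> A}) : {ptws gpow G m.+1 -> A} :=
  fun s => a s + coboundary f s.
rewrite (_ : [set g | _] = D @` [set f | continuous (f : gpow G m -> A)]).
  apply: (continuous_image_compact (f := D)).
    apply: (@continuous_to_prod _ (gpow G m.+1) (fun=> A)) => s.
    apply: continuous_addf; first exact: cst_continuous.
    exact: continuous_coboundary_ptws.
  apply: evenly_continuous_compact => //; exact: gmodule_hausdorff.
by apply/seteqP; split=> [g [f fc ->]|_ [f fc <-]]; exists f.
Qed.

(** The class of a cocycle a consists of the cocycles in the coset of a modulo
    coboundaries; this coset is a continuous image of the compact space of
    continuous cochains, and being a cocycle is a closed condition. *)
Lemma compact_Zcts_class (x : Hcts A m.+1) :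
  compact [set g : {ptws gpow G m.+1 -> A} |
    exists2 b : Zcts A m.+1, Hclass b = x & Zcts_fun b = g].
Proof.
have [a <-] := Hclass_surj x.
have := compact_closedI (@compact_coset_coboundaries (Zcts_fun a))
  (@closed_cocycles m.+1).
congr compact; apply/seteqP; split=> [g [[f fc gE] gz]|_ [b ba <-]].
  have gc : continuous (g : gpow G m.+1 -> A).
    rewrite gE; apply: continuous_addf; first exact: Zcts_continuous.
    exact: continuous_coboundary.
  exists (mkZcts gc gz) => //; apply/Hclass_eq/cohomologous_sym.
  by exists (mkMcts fc) => s; rewrite mkZctsE gE.
split; last exact: Zcts_cocycle.
have /Hclass_eq[f fP] := esym ba.
by exists (Mcts_fun f); [exact: Mcts_continuous | apply/funext].
Qed.

(** For cocycles [a] and [b], these cochains are the witnesses that [a] and [b]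
    are cohomologous. *)
Lemma compact_primitives (a b : gpow G m.+1 -> A) :
  compact [set f : {ptws gpow G m -> A} | continuous (f : gpow G m -> A) /\
    forall s, b s = a s + coboundary f s].
Proof.
apply: compact_closedI.
  by apply: evenly_continuous_compact => //; exact: gmodule_hausdorff.
move=> f clf s.
have cl : closed [set g : {ptws gpow G m -> A} | b s = a s + coboundary g s].
  apply: closed_equalizer; first exact: gmodule_hausdorff.
    exact: cst_continuous.
  apply: continuous_addf; first exact: cst_continuous.
  exact: continuous_coboundary_ptws.
by apply: cl => U /clf [g [gz Ug]]; exists g; split=> //; exact: gz.
Qed.

(** Coboundaries form a compact, hence closed, set of functions, so the relation
    of being cohomologous is closed; an open quotient map by a closed
    equivalence relation has a Hausdorff target. *)
Lemma hausdorff_Hcts : hausdorff_space (Hcts A m.+1).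
Proof.
move=> p q; have [a <-] := Hclass_surj p; have [b <-] := Hclass_surj q => clpq.
apply/Hclass_eq.
pose D (x : Zcts A m.+1 * Zcts A m.+1) : {ptws gpow G m.+1 -> A} :=
  fun s => Zcts_fun x.2 s - Zcts_fun x.1 s.
have Dc : continuous D.
  apply: (@continuous_to_prod _ (gpow G m.+1) (fun=> A)) => s.
  apply: continuous_addf; [|apply: continuous_oppf];
    apply: (continuous_compose (continuous_Zcts_eval (s := s))) => z.
    exact: cvg_snd.
  exact: cvg_fst.
have clB := compact_closed (@hausdorff_ptws _)
  (@compact_coset_coboundaries (fun=> 0)).
have [f fc fE] : [set g : {ptws gpow G m.+1 -> A} |
    exists2 f : gpow G m -> A, continuous f & g = (fun s => 0 + coboundary f s)]
    (D (a, b)).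
  apply: clB => N ND.
  have [[U V] [/= aU bV] UVN] := nbhs_preimage Dc ND.
  have nH (c : Zcts A m.+1) W : nbhs c W -> nbhs (Hclass c) (@Hclass G A m.+1 @` W).
    rewrite nbhsE => -[O [oO Oc] OW].
    apply: (@filterS _ _ _ (@Hclass G A m.+1 @` O)); first exact: image_subset.
    by apply: open_nbhs_nbhs; split; [exact: open_Hclass | exists c].
  have [_ [[a' Ua' <-] [b' Vb' /Hclass_eq/cohomologous_sym [f fP]]]] :=
    clpq _ _ (nH _ _ aU) (nH _ _ bV).
  exists (D (a', b')); split; last exact: (UVN (a', b')).
  exists (Mcts_fun f); first exact: Mcts_continuous.
  by apply/funext => s; rewrite /D /= fP addrAC subrr.
exists (mkMcts fc) => s; have /(congr1 (fun g => g s)) := fE.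
by rewrite /D /= add0r mkMctsE => <-; rewrite addrC subrK.
Qed.

End Compact.

Lemma compact_Hcts n :
  compact [set: A] -> evenly_continuous_wrt A (gpow G n) ->
  compact [set: Hcts A n].
Proof.
move=> cA ecn.
have cM : compact [set: Mcts (gpow G n) A].
  apply: compact_set_typeT; apply: evenly_continuous_compact => //.
  exact: gmodule_hausdorff.
have cZ : compact [set: Zcts A n].
  apply: compact_set_typeT; apply: (subclosed_compact _ cM) => //.
  have /continuous_closedP cl := @continuous_Mcts_fun (gpow G n).
  exact: (cl _ (@closed_cocycles n)).
rewrite (_ : setT = @Hclass G A n @` setT).
  by apply: continuous_image_compact => //; exact: continuous_Hclass.
apply/seteqP; split=> // x _; have [a ax] := Hclass_surj x; by exists a.
Qed.

End Module.
End Cochains.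

Lemma continuous_Hcts_push (G : topologicalGroupType) (A B : gModuleType G)
    (v : {ghom A -> B}) n : continuous (@Hcts_push G A B v n).
Proof.
apply/quotient_continuous.
rewrite (_ : _ \o _ = fun a => Hclass (Zcts_push v a)); last first.
  by apply/funext => a; exact: Hcts_pushE.
apply: continuous_compose; first exact: continuous_Hclass.
apply: continuous_to_Zcts => s.
apply: (@continuous_compose _ _ _ (fun a : Zcts A n => Zcts_fun a s) v).
  by move=> z; exact: cts_fun.
exact: continuous_Zcts_eval.
Qed.

(** * Inverse limits *)

Section Limits.
Context (d : Order.disp_t) (R : porderType d).

Section Topological.
Context (X : R -> topologicalType).
Context (f : forall r s : R, (s <= r)%O -> X r -> X s).

Lemma continuous_to_invlim (Z : topologicalType) (h : Z -> invlim f) :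
  (forall r, continuous (fun z => invlim_proj (h z) r)) -> continuous h.
Proof.
by move=> hc; apply: continuous_to_set_type; apply: continuous_to_prod.
Qed.

Lemma invlim_ext (x y : invlim f) :
  (forall r, invlim_proj x r = invlim_proj y r) -> x = y.
Proof. by move=> xy; apply/val_inj/functional_extensionality_dep. Qed.

Lemma invlim_compat (x : invlim f) r s (h : (s <= r)%O) :
  f h (invlim_proj x r) = invlim_proj x s.
Proof. exact: (set_valP x). Qed.

Lemma hausdorff_invlim :
  (forall r, hausdorff_space (X r)) -> hausdorff_space (invlim f).
Proof. by move=> hX; apply: hausdorff_set_type; exact: hausdorff_product. Qed.

Definition mkInvlim (x : forall r, X r)
    (xf : forall r s (h : (s <= r)%O), f h (x r) = x s) : invlim f :=
  exist _ (x : prod_topology X) (mem_set xf).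

Context (Y : topologicalType) (p : forall r, Y -> X r).
Hypothesis limY : is_invlim f p.

Lemma is_invlim_sep (y y' : Y) : (forall r, p r y = p r y') -> y = y'.
Proof.
have [u up [_ [g [uK _ _]]]] := limY; move=> pyy'.
by apply: (can_inj uK); apply: invlim_ext => r; rewrite !up.
Qed.

Lemma is_invlim_compat r s (h : (s <= r)%O) y : f h (p r y) = p s y.
Proof. by have [u up _] := limY; rewrite -!up invlim_compat. Qed.

Lemma is_invlim_lift (Z : topologicalType) (h : forall r, Z -> X r) :
  (forall r, continuous (h r)) ->
  (forall r s (l : (s <= r)%O) z, f l (h r z) = h s z) ->
  exists2 g : Z -> Y, continuous g & forall r z, p r (g z) = h r z.
Proof.
move=> hc hf; have [u up [_ [v [_ vK vc]]]] := limY.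
pose k z := mkInvlim (fun r s l => hf r s l z).
exists (fun z => v (k z)) => [|r z]; last by rewrite -up vK.
by apply: continuous_compose => //; exact: continuous_to_invlim.
Qed.

End Topological.

Section System.
Context (G : topologicalGroupType) (S : gInverseSystem R G) (A : gModuleType G).
Context (phi : forall r : R, {ghom A -> S r}).
Hypotheses (dR : directed R) (limA : is_gInvlim phi).

Lemma glim_sep (x y : A) : (forall r, phi r x = phi r y) -> x = y.
Proof. exact: (is_invlim_sep limA). Qed.

Lemma glim_compat r s (h : (s <= r)%O) (x : A) : gsys_map S h (phi r x) = phi s x.
Proof. exact: (is_invlim_compat limA). Qed.

(** This is how compactness produces objects over [A]: nonempty compact sets of
    continuous functions into the [S r], stable under the transition maps, have a
    compatible family of members, which glues to one function into the limit. *)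
Lemma glim_function (D : topologicalType) (K : forall r, set {ptws D -> S r}) :
  (forall r, compact (K r)) -> (forall r, K r !=set0) ->
  (forall r g, K r g -> continuous (g : D -> S r)) ->
  (forall r s (h : (s <= r)%O) g, K r g -> K s (fun t => gsys_map S h (g t))) ->
  exists2 g : D -> A, continuous g & forall r, K r (fun t => phi r (g t)).
Proof.
move=> cK K0 Kc KS.
pose f r s (h : (s <= r)%O) (g : {ptws D -> S r}) : {ptws D -> S s} :=
  fun t => gsys_map S h (g t).
have [x Kx] : exists x : invlim f, forall r, K r (invlim_proj x r).
  apply: invlim_compact_nonempty => //.
  - by move=> r; exact: hausdorff_ptws.
  - move=> r s h; apply: (@continuous_to_prod _ D (fun=> S s)) => t.
    apply: (@continuous_compose _ _ _ (fun g : {ptws D -> S r} => g t)).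
      by move=> z; exact: cts_fun.
    exact: continuous_eval.
  - by move=> r s t rs st rt g; apply/funext => z; exact: gsys_map_comp.
have [g gc gE] := is_invlim_lift limA (fun r => Kc r _ (Kx r))
  (fun r s l z => congr1 (fun g => g z) (invlim_compat x l)).
by exists g => // r; rewrite (_ : (fun t => _) = invlim_proj x r)//; apply/funext.
Qed.

Context (m : nat).
Hypotheses (cS : forall r, compact [set: S r])
  (ecS : forall r, evenly_continuous_wrt (S r) (gpow G m)).

(** The witnesses that the images of [a] and [b] over [r] are cohomologous form
    nonempty compact sets, so they can be chosen compatibly. *)
Lemma cohomologous_glim (a b : Zcts A m.+1) :
  (forall r, cohomologous (Zcts_push (phi r) a) (Zcts_push (phi r) b)) ->
  cohomologous a b.
Proof.
move=> ab.
have [r||r g []//|r s h g [gc gE]|g gc gE] := @glim_function (gpow G m)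
  (fun r => [set f | continuous (f : gpow G m -> S r) /\
    forall s, phi r (Zcts_fun b s) = phi r (Zcts_fun a s) + coboundary f s]).
- exact: (compact_primitives (@cS r) (@ecS r)).
- by move=> r; have [f fP] := ab r; exists (Mcts_fun f); split => //;
    exact: Mcts_continuous.
- split.
    by apply: continuous_compose gc => z; exact: cts_fun.
  move=> t; rewrite -!(glim_compat h) gE raddfD; congr (_ + _).
  exact/esym/coboundary_comp.
exists (mkMcts gc) => s; apply: glim_sep => r.
by rewrite mkMctsE raddfD /= -(coboundary_comp (phi r)); have [_ ->] := gE r.
Qed.

(** The cocycles in the class of [x] over [r] form nonempty compact sets, so
    representatives can be chosen compatibly. *)
Lemma glim_cocycle (x : Hcts_invlim S m.+1) :
  exists a : Zcts A m.+1, forall r, Hclass (Zcts_push (phi r) a) = invlim_proj x r.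
Proof.
have [r|r|r g [b _ <-]|r s h _ [b bx <-]|g gc gE] := @glim_function (gpow G m.+1)
  (fun r => [set g | exists2 b : Zcts (S r) m.+1, Hclass b = invlim_proj x r
                     & Zcts_fun b = g]).
- exact: (compact_Zcts_class (@cS r) (@ecS r)).
- by have [b bx] := Hclass_surj (invlim_proj x r); exists (Zcts_fun b); exists b.
- exact: Zcts_continuous.
- exists (Zcts_push (gsys_map S h) b) => //.
  by rewrite -Hcts_pushE bx; exact: (invlim_compat x).
have gz s : coboundary g s = 0.
  apply: glim_sep => r; rewrite -(coboundary_comp (phi r)) raddf0.
  by have [b _ bE] := gE r; rewrite -[_ \o _]bE Zcts_cocycle.
exists (mkZcts gc gz) => r; have [b <- bE] := gE r; congr Hclass.
by apply: Zcts_fun_inj; rewrite bE.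
Qed.

End System.
End Limits.

(** * The comparison map *)

Theorem theorem2 (G : topologicalGroupType) (n : nat)
    (d : Order.disp_t) (R : porderType d)
    (S : gInverseSystem R G) (A : gModuleType G)
    (phi : forall r : R, {ghom A -> S r}) :
  compact [set: G] -> hausdorff_space G ->
  (1 <= n)%N ->
  directed R ->
  (forall r : R, compact [set: S r]) ->
  (forall r : R, evenly_continuous_wrt (S r) (gpow G n.-1)) ->
  compact [set: A] ->
  is_gInvlim phi ->
  exists Theta : Hcts A n -> Hcts_invlim S n,
    [/\ (forall (a : Zcts A n) (r : R),
           invlim_proj (Theta (Hclass a)) r = Hclass (Zcts_push (phi r) a)),
        continuous Theta,
        bijective Theta,
        (forall (T : gInverseSystem R G) (B : gModuleType G)
                (psi : forall r : R, {ghom B -> T r})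
                (Theta' : Hcts B n -> Hcts_invlim T n)
                (u : gSystemHom S T) (v : {ghom A -> B}),
           is_gInvlim psi ->
           (forall (b : Zcts B n) (r : R),
              invlim_proj (Theta' (Hclass b)) r = Hclass (Zcts_push (psi r) b)) ->
           (forall (r : R) (x : A), psi r (v x) = u r (phi r x)) ->
           forall (x : Hcts A n) (r : R),
             invlim_proj (Theta' (Hcts_push v x)) r =
             Hcts_push (u r) (invlim_proj (Theta x) r))
      & evenly_continuous_wrt A (gpow G n) -> homeomorphism Theta].
Proof.
move=> _ _; case: n => [//|m] _ dR cS ecS cA limA.
have compat (x : Hcts A m.+1) r s (h : (s <= r)%O) :
    Hcts_push (gsys_map S h) (Hcts_push (phi r) x) = Hcts_push (phi s) x.
  have [a <-] := Hclass_surj x; rewrite !Hcts_pushE; congr Hclass.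
  by apply: Zcts_fun_inj; apply/funext => t; exact: (glim_compat limA).
pose Theta (x : Hcts A m.+1) : Hcts_invlim S m.+1 := mkInvlim (compat x).
have ThetaE (a : Zcts A m.+1) r :
    invlim_proj (Theta (Hclass a)) r = Hclass (Zcts_push (phi r) a).
  exact: Hcts_pushE.
have Thetac : continuous Theta.
  by apply: continuous_to_invlim => r; exact: continuous_Hcts_push.
have ThetaI : injective Theta.
  move=> x y; have [a <-] := Hclass_surj x; have [b <-] := Hclass_surj y => ab.
  apply/Hclass_eq; apply: (cohomologous_glim dR limA cS ecS) => r.
  by apply/Hclass_eq; rewrite -!ThetaE ab.
have [inv invE] : exists inv, cancel inv Theta.
  have ex y : exists x, Theta x = y.
    have [a aE] := glim_cocycle dR limA cS ecS y; exists (Hclass a).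
    by apply: invlim_ext => r; rewrite ThetaE.
  by have [inv invE] := choice ex; exists inv.
have Theta_inv : cancel Theta inv by move=> x; apply: ThetaI; rewrite invE.
exists Theta; split => //.
- by exists inv.
- move=> T B psi Theta' u v _ Theta'E psiv x r.
  have [a <-] := Hclass_surj x; rewrite ThetaE !Hcts_pushE Theta'E; congr Hclass.
  by apply: Zcts_fun_inj; apply/funext => t; exact: psiv.
move=> ecA; split => //; exists inv; split => //.
apply: (compact_hausdorff_inverse _ _ Thetac Theta_inv invE).
  exact: compact_Hcts.
by apply: hausdorff_invlim => r; exact: hausdorff_Hcts.
Qed.
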